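(* Let $(\mathfrak{L}^{n+1},\mathfrak{g})$ be a static spacetime and $P^n\hookrightarrow\mathfrak{L}^{n+1}$ a non-degenerate photon sphere. Then $$NH=(n-1)\,\nu(N)$$ holds for all canonical time slices of $P^n$ (without assuming any field equations). In particular, (non-degenerate) photon spheres satisfy $\nu(N)H>0$ (or, alternatively, $\eta(N)\mathfrak{H}>0$) and have $H=\text{const.}$ if and only if $\nu(N)=\text{const.}$ along any, or every, time slice of $P^n$ (or, alternatively, $\mathfrak{H}=\text{const.}$ if and only if $\eta(N)=\text{const.}$ along $P^n$).
   Context: All manifolds and tensor fields are smooth, manifolds are connected, submanifolds embedded; $n\ge3$. Static spacetime: $\mathfrak{L}^{n+1}=\mathbb{R}\times M^n$, $\mathfrak{g}=-N^2dt^2+g$ with $(M^n,g)$ Riemannian and $N\colon M^n\to(0,\infty)$; $M^n(t)$ is the time slice at $t$. Photon sphere: a timelike totally umbilic hypersurface of the form $P^n=\mathbb{R}\times\Sigma^{n-1}$, $\Sigma^{n-1}\hookrightarrow M^n$ a hypersurface, along which $N$ is constant. Non-degenerate: $dN\ne0$ at every point of $P^n$. $\eta$ is a unit normal to $P^n$ and $\nu$ the induced unit normal to the canonical time slices $\Sigma^{n-1}(t)=P^n\cap M^n(t)$ in $M^n(t)$ (here $\eta=\nu$). $\mathfrak{H}$ and $H$ are the mean curvatures of $P^n\hookrightarrow\mathfrak{L}^{n+1}$ and $\Sigma^{n-1}(t)\hookrightarrow M^n(t)$, the traces of $\mathfrak{h}(X,Y)=-\mathfrak{g}(\nabla_XY,\eta)$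 and $h(X,Y)=-g(\nabla_XY,\nu)$. *)

(* Defs.v *)
From HB Require Import structures.
From mathcomp Require Import all_boot all_order all_algebra.
From mathcomp Require Import all_classical all_reals all_analysis.
Set Implicit Arguments. Unset Strict Implicit. Unset Printing Implicit Defensive.
Import Order.TTheory GRing.Theory Num.Theory.
Import numFieldNormedType.Exports.
Local Open Scope classical_set_scope.
Local Open Scope ring_scope.

(* C^oo on U: for open U, all iterated directional derivatives exist and are
   Frechet differentiable (hence continuous) on U. *)
Definition smooth_on (R : realType) (V W : normedModType R) (U : set V)
    (f : V -> W) : Prop :=
  forall (s : seq V) (x : V), U x ->
    differentiable (foldr (fun v h => 'D_v h) f s) x.

(* The maps are total functions, relevant only on [csource] and [ctarget]. *)
Record chart (R : realType) (T : topologicalType) (n : nat) := Chart {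
  csource : set T;
  ctarget : set 'rV[R]_n;
  cmap :> T -> 'rV[R]_n;
  cinv : 'rV[R]_n -> T;
  csource_open : open csource;
  ctarget_open : open ctarget;
  cmap_target : forall p, csource p -> ctarget (cmap p);
  cinv_source : forall y, ctarget y -> csource (cinv y);
  cmapK : forall p, csource p -> cinv (cmap p) = p;
  cinvK : forall y, ctarget y -> cmap (cinv y) = y;
  cmap_cont : forall p, csource p -> {for p, continuous cmap};
  cinv_cont : forall y, ctarget y -> {for y, continuous cinv} }.

(* A topological space with an atlas, and a preferred chart of the atlas around
   each point, in which tangent vectors at that point are expressed. *)
Record charted (R : realType) (n : nat) := Charted {
  carrier :> topologicalType;
  atlas : set (chart R carrier n);
  chart_at : carrier -> chart R carrier n;
  chart_at_atlas : forall p, atlas (chart_at p);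
  chart_at_source : forall p, csource (chart_at p) p }.

Definition smooth_manifold (R : realType) (n : nat) (M : charted R n) : Prop :=
  [/\ hausdorff_space M, @second_countable M, connected [set: M]
    & forall c c' : chart R M n, atlas c -> atlas c' ->
      smooth_on (ctarget c `&` cinv c @^-1` csource c') (c' \o cinv c)].

(* The tangent space at p: components in the chart [chart_at p]. *)
Definition tangent (R : realType) (n : nat) (M : charted R n) (p : M) : Type :=
  'rV[R]_n.

Section Tensors.
Variables (R : realType) (k n : nat) (S : charted R k) (M : charted R n).

(* components in the chart c of a tangent vector at p *)
Definition tcoord (c : chart R M n) (p : M) (v : tangent p) : 'rV[R]_n :=
  v *m 'J (c \o cinv (chart_at p)) (chart_at p p).

(* the vector at p with components w in the chart c, so that
   [coord_field c w] is the vector field w^i d_i of that chart *)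
Definition coord_field (c : chart R M n) (w : 'rV[R]_n) (p : M) : tangent p :=
  w *m 'J (chart_at p \o cinv c) (c p).

Definition smooth_fun (N : M -> R) : Prop :=
  forall c : chart R M n, atlas c -> smooth_on (ctarget c) (N \o cinv c).

(* v(N) *)
Definition vderiv (N : M -> R) (p : M) (v : tangent p) : R :=
  'D_v (N \o cinv (chart_at p)) (chart_at p p).

Definition smooth_map (f : S -> M) : Prop :=
  continuous f /\
  forall (d : chart R S k) (c : chart R M n), atlas d -> atlas c ->
    smooth_on (ctarget d `&` (f \o cinv d) @^-1` csource c) (c \o f \o cinv d).

(* the differential T_x S -> T_(f x) M *)
Definition mdiff (f : S -> M) (x : S) (v : tangent x) : tangent (f x) :=
  v *m 'J (chart_at (f x) \o f \o cinv (chart_at x)) (chart_at x x).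

Definition embedding (f : S -> M) : Prop :=
  [/\ smooth_map f,
      forall (x : S) (v : tangent x), mdiff f v = 0 -> v = 0,
      injective f
    & forall U : set S, open U -> exists2 V : set M, open V & U = f @^-1` V].

(* Vector fields along f, i.e. sections of the pulled back tangent bundle. *)
Definition smooth_along (f : S -> M) (Y : forall x, tangent (f x)) : Prop :=
  forall (d : chart R S k) (c : chart R M n), atlas d -> atlas c ->
    smooth_on (ctarget d `&` (f \o cinv d) @^-1` csource c)
              (fun y => tcoord c (Y (cinv d y))).

(* A (0,2)-tensor: its matrix at p is taken in the chart [chart_at p]. *)
Definition tensor02 : Type := M -> 'M[R]_n.

Definition inner (g : tensor02) (p : M) (v w : tangent p) : R :=
  ((v : 'rV_n) *m g p *m (w : 'rV_n)^T) 0 0.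

(* the matrix g_ij in the chart c, at the point of coordinates y *)
Definition gram (g : tensor02) (c : chart R M n) (y : 'rV[R]_n) : 'M[R]_n :=
  \matrix_(i, j) inner g (coord_field c (delta_mx 0 i) (cinv c y))
                         (coord_field c (delta_mx 0 j) (cinv c y)).

Definition smooth_tensor (g : tensor02) : Prop :=
  forall c : chart R M n, atlas c ->
    forall i j, smooth_on (ctarget c) (fun y => gram g c y i j).

Definition riemannian (g : tensor02) : Prop :=
  [/\ smooth_tensor g, forall p, (g p)^T = g p
    & forall p (v : tangent p), v != 0 :> 'rV_n -> 0 < inner g v v].

(* Christoffel symbol Gamma^l_ij of the Levi-Civita connection in the chart c *)
Definition christoffel (g : tensor02) (c : chart R M n) (y : 'rV[R]_n)
    (l i j : 'I_n) : R :=
  let dg (a b e : 'I_n) :=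
    'D_(delta_mx 0 a) (fun z => gram g c z b e) y in
  2^-1 * \sum_(m < n) invmx (gram g c y) l m * (dg i j m + dg j i m - dg m i j).

(* The Levi-Civita derivative nabla_v Y at x of a vector field Y along f, for v
   tangent to S at x: it has components v(Y^l) + Gamma^l_ij df(v)^i Y^j. *)
Definition cov_deriv (g : tensor02) (f : S -> M) (Y : forall x, tangent (f x))
    (x : S) (v : tangent x) : tangent (f x) :=
  let c := chart_at (f x) in
  'D_v (fun y => tcoord c (Y (cinv (chart_at x) y))) (chart_at x x)
  + \row_l \sum_i \sum_j christoffel g c (c (f x)) l i j *
             (mdiff f v : 'rV_n) 0 i * (Y x : 'rV_n) 0 j.

End Tensors.

Section Hypersurfaces.
Variables (R : realType) (k n : nat) (S : charted R k) (M : charted R n).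
Variables (g : tensor02 M) (f : S -> M).

(* matrix of the pulled back tensor f^* g *)
Definition induced : tensor02 S := fun x =>
  \matrix_(i, j) inner g (mdiff f (delta_mx 0 i : tangent x))
                         (mdiff f (delta_mx 0 j : tangent x)).

Definition unit_normal_at (x : S) (nu : tangent (f x)) : Prop :=
  inner g nu nu = 1 /\ forall v : tangent x, inner g nu (mdiff f v) = 0.

Definition unit_normal (nu : forall x, tangent (f x)) : Prop :=
  smooth_along nu /\ forall x, unit_normal_at (nu x).

(* h(v, w) = - g(nabla_v W, nu) at x, where w is extended to the vector field W
   with constant components in the chart [chart_at x]; as h is a tensor,
   the choice of the extension is irrelevant. *)
Definition second_form (x : S) (nu : tangent (f x)) (v w : tangent x) : R :=
  - inner g
      (cov_deriv g (fun x' => mdiff f (coord_field (chart_at x) w x')) v) nu.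

(* trace of h with respect to the induced metric *)
Definition mean_curvature (x : S) (nu : tangent (f x)) : R :=
  \tr (invmx (induced x) *m
       \matrix_(i, j) second_form nu (delta_mx 0 i) (delta_mx 0 j)).

(* The condition does not depend on which of the two unit normals is used. *)
Definition totally_umbilic : Prop :=
  forall (x : S) (nu : tangent (f x)), unit_normal_at nu ->
    exists lambda : R, forall v w : tangent x,
      second_form nu v w = lambda * inner induced v w.

(* the induced metric is Lorentzian, of signature (-,+,...,+) *)
Definition timelike : Prop :=
  forall x : S, exists2 A : 'M[R]_k, A \in unitmx &
    A *m induced x *m A^T
      = diag_mx (\row_i (if i == 0%N :> nat then -1 else 1)).

End Hypersurfaces.

Arguments mean_curvature {R k n S M} g f {x} nu.

Lemma continuous_mx (R : realType) (T : topologicalType) (m n : nat)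
    (F : T -> 'M[R]_(m, n)) (x : T) :
  (forall i j, {for x, continuous (fun z => F z i j)}) ->
  {for x, continuous F}.
Proof.
move=> cF A [P FP sPA]; have /filterS : nbhs x [set z | forall i j, P i j (F z i j)].
  by do 2![apply: filter_forall => ?]; exact: (cF _ _ _ (FP _ _)).
by apply => z Pz; apply: sPA.
Qed.

Section TimeProduct.
Variables (R : realType) (n : nat).

Obligation Tactic := idtac.

(* id x c on R x T *)
Program Definition time_chart (T : topologicalType) (c : chart R T n) :
    chart R (R * T)%type (1 + n) :=
  {| csource := [set q | csource c q.2];
     ctarget := [set y | ctarget c (rsubmx y)];
     cmap := fun q => row_mx (const_mx q.1) (c q.2);
     cinv := fun y => (lsubmx y 0 0, cinv c (rsubmx y)) |}.
Next Obligation.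
move=> T c; apply: (@open_comp _ _ snd); last exact: csource_open.
by move=> q _; exact: cvg_snd.
Qed.
Next Obligation.
move=> T c; apply: (@open_comp _ _ (@rsubmx R 1 1 n)); last exact: ctarget_open.
by move=> y _; exact: continuous_rsubmx.
Qed.
Next Obligation.
by move=> T c [t p] /= cp; rewrite row_mxKr; exact: cmap_target.
Qed.
Next Obligation.
by move=> T c y /= cy; exact: cinv_source.
Qed.
Next Obligation.
by move=> T c [t p] /= cp; rewrite row_mxKl row_mxKr mxE cmapK.
Qed.
Next Obligation.
move=> T c y /= cy; rewrite cinvK // -[RHS]hsubmxK; congr row_mx.
by apply/rowP => i; rewrite mxE ord1.
Qed.
Next Obligation.
move=> T c [t p] /= cp; apply: continuous_mx => i j.
case: (splitP j) => k jk.
  have -> : j = lshift n k by exact: val_inj.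
  rewrite (_ : (fun z => _) = fst); first exact: cvg_fst.
  by apply/funext => z; rewrite row_mxEl mxE.
have -> : j = rshift 1 k by exact: val_inj.
rewrite (_ : (fun z => _) = (fun y : 'rV[R]_n => y i k) \o (c \o snd)); last first.
  by apply/funext => z; rewrite row_mxEr.
apply: (@continuous_comp _ _ _ (c \o snd) (fun y : 'rV[R]_n => y i k));
  last exact: coord_continuous.
by apply: (@continuous_comp _ _ _ snd c); [exact: cvg_snd | exact: cmap_cont].
Qed.
Next Obligation.
move=> T c y /= cy.
have c1 : {for y, continuous (fun z : 'rV[R]_(1 + n) => lsubmx z 0 0)}.
  apply: (@continuous_comp _ _ _ (@lsubmx R 1 1 n) (fun z : 'M[R]_1 => z 0 0)).
    exact: continuous_lsubmx.
  exact: coord_continuous.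
have c2 : {for y, continuous (fun z : 'rV[R]_(1 + n) => cinv c (rsubmx z))}.
  apply: (@continuous_comp _ _ _ (@rsubmx R 1 1 n) (cinv c)).
    exact: continuous_rsubmx.
  exact: cinv_cont.
exact: (cvg_pair c1 c2).
Qed.

(* R x M; a tangent vector at (t, p) is [row_mx tau v] with v tangent at p. *)
Program Definition time_product (M : charted R n) : charted R (1 + n) :=
  {| carrier := (R * M)%type;
     atlas := [set time_chart c | c in @atlas R n M];
     chart_at := fun q => time_chart (chart_at q.2) |}.
Next Obligation.
by move=> M q /=; exists (chart_at q.2) => //; exact: chart_at_atlas.
Qed.
Next Obligation.
by move=> M q /=; exact: chart_at_source.
Qed.

End TimeProduct.

Section StaticSpacetime.
Variables (R : realType) (k n : nat) (S : charted R k) (M : charted R n).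

(* - N^2 dt^2 + g on R x M *)
Definition static_metric (N : M -> R) (g : tensor02 M) :
    tensor02 (time_product M) :=
  fun q => block_mx (- N q.2 ^+ 2)%:M 0 0 (g q.2).

Definition static_spacetime (N : M -> R) (g : tensor02 M) : Prop :=
  [/\ smooth_manifold M, riemannian g, smooth_fun N & forall p, 0 < N p].

(* the inclusion of R x S in R x M *)
Definition cylinder (f : S -> M) : time_product S -> time_product M :=
  fun q => (q.1, f q.2).

(* N as a function on R x M *)
Definition static_fun (N : M -> R) : time_product M -> R := fun q => N q.2.

Definition photon_sphere (N : M -> R) (g : tensor02 M) (f : S -> M) : Prop :=
  [/\ smooth_manifold S /\ embedding f,
      timelike (static_metric N g) (cylinder f),
      totally_umbilic (static_metric N g) (cylinder f)
    & exists a : R, forall q, static_fun N (cylinder f q) = a].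

Definition non_degenerate (N : M -> R) (f : S -> M) : Prop :=
  forall q, exists v : tangent (cylinder f q), vderiv (static_fun N) v != 0.

(* The unit normal induced by eta on the slice S(t) of the cylinder. As eta is
   orthogonal to d_t its time component vanishes, and eta = nu as vectors. *)
Definition slice_normal (f : S -> M) (eta : forall q, tangent (cylinder f q))
    (t : R) (x : S) : tangent (f x) :=
  @rsubmx R 1 1 n (eta (t, x)).

End StaticSpacetime.

(* Main.v *)
(** In [chart_at p] the coordinate frame at p is the standard basis, so lowering
    the index of the Christoffel symbols expresses the second fundamental form
    through first derivatives of the Gram matrix of the metric, without inverse
    metric. The Gram matrix of -N^2 dt^2 + g is block diagonal; hence the second
    fundamental form of the cylinder R x Sigma is h on vectors tangent to Sigma,
    takes the value -N nu(N) on (d_t, d_t), and vanishes on mixed pairs.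
    Umbilicity, tested on (d_t, d_t), forces the factor lambda = nu(N) / N, and
    the traces are H = (n - 1) lambda and HH = n lambda.
    As N is constant on Sigma, dN kills the tangent space of Sigma; since dN
    does not vanish, nu(N) <> 0. Two unit normals at a point differ by a sign,
    and t |-> nu_t(N) is continuous without zeros, so nu(N) does not depend on
    t. *)
Require Import Defs.
From mathcomp Require Import all_boot all_order all_algebra.
From mathcomp Require Import ring.
From mathcomp Require Import all_classical all_reals all_analysis.
Set Implicit Arguments. Unset Strict Implicit. Unset Printing Implicit Defensive.
Import Order.TTheory GRing.Theory Num.Theory.
Import numFieldNormedType.Exports.
Local Open Scope classical_set_scope.
Local Open Scope ring_scope.

(** * Differential calculus of maps between normed and matrix spaces *)

Section Calculus.
Variable R : realType.

(** The first-order expansion of [f] at [x] depends only on the germ, so it is also one of [g].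
    Chart expressions are compared this way, since they usually agree only near a point. *)
Lemma near_eq_differentiable (V W : normedModType R) (f g : V -> W) (x : V) :
  (\forall y \near x, f y = g y) -> differentiable f x -> differentiable g x.
Proof.
move=> fg df.
suff dg : g \o shift x = cst (g x) + 'd f x +o_ 0 id.
  have e := diff_unique (diff_continuous df) dg.
  by apply/diff_locallyP; rewrite e; split=> //; exact: diff_continuous.
have /eqaddoP of0 := diff_locally df.
apply/eqaddoP => e e0; have := of0 e e0; apply: filter_app.
have gx : f x = g x := nbhs_singleton fg.
have : \forall h \near 0, f (h + x) = g (h + x).
  by move: fg; rewrite (near_shift 0 x); apply: filterS => h /=; rewrite subr0.
by apply: filterS => h fgh; rewrite !fctE /= gx fgh.
Qed.

(** [L] is a finite sum of entry functions times the fixed vectors [L (delta_mx i j)]. *)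
Lemma linear_mx_continuous (m n : nat) (W : normedModType R)
    (L : {linear 'M[R]_(m, n) -> W}) : continuous L.
Proof.
move=> A; apply: differentiable_continuous.
have -> : (L : 'M[R]_(m, n) -> W) =
    \sum_i \sum_j (fun B : 'M[R]_(m, n) => B i j *: L (delta_mx i j) : W).
  apply/funext => B; rewrite [in LHS](matrix_sum_delta B) linear_sum fct_sumE.
  apply: eq_bigr => i _; rewrite linear_sum fct_sumE.
  by apply: eq_bigr => j _; rewrite linearZ.
apply: differentiable_sum => i; apply: differentiable_sum => j.
by apply: differentiableZl; exact: differentiable_coord.
Qed.

Lemma differentiable_linear_mx (m n : nat) (V W : normedModType R)
    (L : {linear 'M[R]_(m, n) -> W}) (F : V -> 'M[R]_(m, n)) (x : V) :
  differentiable F x -> differentiable (fun y => L (F y)) x.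
Proof.
move=> dF; apply: (differentiable_comp dF).
exact/linear_differentiable/linear_mx_continuous.
Qed.

Lemma derive_linear_mx (m n : nat) (V W : normedModType R)
    (L : {linear 'M[R]_(m, n) -> W}) (F : V -> 'M[R]_(m, n)) (x v : V) :
  differentiable F x -> 'D_v (fun y => L (F y)) x = L ('D_v F x).
Proof.
move=> dF; have dL y : differentiable L y.
  exact/linear_differentiable/linear_mx_continuous.
rewrite deriveE; last exact: differentiable_comp.
rewrite (diff_comp dF (dL _)) /= diff_lin ?deriveE //.
exact: linear_mx_continuous.
Qed.

Lemma differentiable_mx (m n : nat) (V : normedModType R)
    (F : V -> 'M[R]_(m, n)) (x : V) :
  (forall i j, differentiable (fun y => F y i j) x) -> differentiable F x.
Proof.
move=> dF.
have -> : F = \sum_i \sum_j (fun y => F y i j *: delta_mx i j : 'M[R]_(m, n)).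
  apply/funext => y; rewrite {1}(matrix_sum_delta (F y)) fct_sumE.
  by apply: eq_bigr => i _; rewrite fct_sumE.
apply: differentiable_sum => i; apply: differentiable_sum => j.
exact: differentiableZl.
Qed.

Lemma derive_mx_coord (m n : nat) (V : normedModType R)
    (F : V -> 'M[R]_(m, n)) (x v : V) i j :
  differentiable F x -> 'D_v (fun y => F y i j) x = 'D_v F x i j.
Proof. by move=> dF; rewrite derive_mx ?mxE //; exact: diff_derivable. Qed.

Lemma derive_comp (U V W : normedModType R) (f : U -> V) (g : V -> W) x v :
  differentiable f x -> differentiable g (f x) ->
  'D_v (g \o f) x = 'D_('D_v f x) g (f x).
Proof.
move=> df dg; rewrite !deriveE //; last exact: differentiable_comp.
by rewrite diff_comp.
Qed.

Lemma row_jacobian (m n : nat) (f : 'rV[R]_m -> 'rV[R]_n) x i :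
  differentiable f x -> row i ('J f x) = 'D_(delta_mx 0 i) f x.
Proof. by move=> df; rewrite (deriveEjacobian _ df) -rowE. Qed.

Lemma jacobian_comp (m n p : nat) (f : 'rV[R]_m -> 'rV[R]_n)
    (g : 'rV[R]_n -> 'rV[R]_p) x y :
  f x = y -> differentiable f x -> differentiable g y ->
  'J (g \o f) x = 'J f x *m 'J g y.
Proof.
move=> <- df dg; apply/row_matrixP => i; rewrite row_mul.
rewrite (row_jacobian _ (differentiable_comp df dg)) (derive_comp _ df dg).
by rewrite (deriveEjacobian _ dg) (row_jacobian _ df).
Qed.

Lemma near_eq_jacobian (m n : nat) (f g : 'rV[R]_m -> 'rV[R]_n) x :
  (\forall y \near x, f y = g y) -> differentiable f x -> 'J f x = 'J g x.
Proof.
move=> fg df; apply/row_matrixP => i.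
rewrite [LHS](row_jacobian _ df).
rewrite [RHS](row_jacobian _ (near_eq_differentiable fg df)).
exact: near_eq_derive.
Qed.

Lemma jacobian_id (n : nat) (f : 'rV[R]_n -> 'rV[R]_n) x :
  (\forall y \near x, f y = y) -> 'J f x = 1%:M.
Proof.
move=> fx; have did : differentiable (@id 'rV[R]_n) x by exact: ex_diff.
transitivity ('J (@id 'rV[R]_n) x).
  by apply/esym/near_eq_jacobian => //; near do apply/esym.
by apply/row_matrixP => i; rewrite (row_jacobian _ did) derive_id row1.
Unshelve. all: by end_near. Qed.

(** * Maps of the form id x phi on R x R^k *)

Section Lift.
Variables k n : nat.
Implicit Type phi : 'rV[R]_k -> 'rV[R]_n.

(** The coordinate form shared by chart transitions of a time product and by chart expressions of a
    cylinder. *)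
Definition lift_time phi (y : 'rV[R]_(1 + k)) : 'rV[R]_(1 + n) :=
  row_mx (lsubmx y) (phi (rsubmx y)).

(** Written as a sum of linear images of [lsubmx y] and [phi (rsubmx y)], the map can be
    differentiated by the sum and linearity rules. *)
Lemma lift_timeE phi : lift_time phi =
  (fun y => lsubmx y *m (row_mx 1%:M 0 : 'M[R]_(1, 1 + n)))
  + (fun y => phi (rsubmx y) *m (row_mx 0 1%:M : 'M[R]_(n, 1 + n))).
Proof.
apply/funext => y; rewrite /lift_time !fctE !mul_mx_row !mulmx0 !mulmx1.
by rewrite add_row_mx addr0 add0r.
Qed.

Lemma differentiable_comp_rsubmx (W : normedModType R) (F : 'rV[R]_k -> W)
    (y : 'rV[R]_(1 + k)) :
  differentiable F (rsubmx y) -> differentiable (fun z => F (rsubmx z)) y.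
Proof.
move=> dF; have dr : differentiable (@rsubmx R 1 1 k) y.
  exact: differentiable_rsubmx.
exact: (differentiable_comp dr dF).
Qed.

(** The difference quotients themselves coincide, [rsubmx] being linear. *)
Lemma derive_comp_rsubmx (W : normedModType R) (F : 'rV[R]_k -> W)
    (y v : 'rV[R]_(1 + k)) :
  'D_v (fun z => F (rsubmx z)) y = 'D_(rsubmx v) F (rsubmx y).
Proof.
rewrite /derive; apply: (congr1 (fun G : R -> W => lim (G @ 0^'))).
apply/funext => h /=; congr (_ *: (F _ - _)).
by apply/rowP => i; rewrite !mxE.
Qed.

Lemma differentiable_lift_time phi y :
  differentiable phi (rsubmx y) -> differentiable (lift_time phi) y.
Proof.
move=> dphi; rewrite lift_timeE; apply: differentiableD.
  exact: (differentiable_linear_mx (mulmxr _) (differentiable_lsubmx _)).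
apply: (differentiable_linear_mx (mulmxr _)).
exact: differentiable_comp_rsubmx.
Qed.

Lemma derive_lift_time phi y v : differentiable phi (rsubmx y) ->
  'D_v (lift_time phi) y = row_mx (lsubmx v) ('D_(rsubmx v) phi (rsubmx y)).
Proof.
move=> dphi; rewrite lift_timeE deriveD; last 2 first.
- apply/diff_derivable.
  exact: (differentiable_linear_mx (mulmxr _) (differentiable_lsubmx _)).
- apply/diff_derivable/(differentiable_linear_mx (mulmxr _)).
  exact: differentiable_comp_rsubmx.
rewrite (derive_linear_mx (mulmxr _)); last exact: differentiable_lsubmx.
rewrite (derive_linear_mx (mulmxr _)); last exact: differentiable_comp_rsubmx.
rewrite derive_comp_rsubmx (derive_linear_mx lsubmx) // derive_id /=.
by rewrite !mul_mx_row !mulmx0 !mulmx1 add_row_mx addr0 add0r.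
Qed.

Lemma jacobian_lift_time phi y : differentiable phi (rsubmx y) ->
  'J (lift_time phi) y = block_mx 1%:M 0 0 ('J phi (rsubmx y)).
Proof.
move=> dphi; apply/row_matrixP => i.
rewrite (row_jacobian _ (differentiable_lift_time dphi)) derive_lift_time //.
rewrite (deriveEjacobian _ dphi) rowE -[X in _ = X *m _]hsubmxK.
by rewrite mul_row_block !mulmx0 mulmx1 addr0 add0r.
Qed.

End Lift.
End Calculus.

(** * Lowering the index of the Christoffel symbols *)

Section Christoffel.
Variables (R : realType) (n : nat).
Implicit Types (a b x y z : 'rV[R]_n) (T : 'I_n -> 'M[R]_n).

Lemma trilinear_sum T x y z :
  (x *m (\sum_k z 0 k *: T k) *m y^T) 0 0 =
  \sum_k \sum_i \sum_j z 0 k * x 0 i * y 0 j * T k i j.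
Proof.
rewrite mulmx_sumr mulmx_suml summxE; apply: eq_bigr => k _.
rewrite -scalemxAr -scalemxAl !mxE mulr_sumr exchange_big /=.
apply: eq_bigr => j _; rewrite !mxE mulr_suml mulr_sumr.
by apply: eq_bigr => i _; ring.
Qed.

(* Lowering the index of Gamma^l_ij a^i b^j cancels the inverse metric in the
   Christoffel symbols. *)
Lemma christoffel_lower (G : 'M[R]_n) T a b z :
  G^T = G -> G \in unitmx ->
  ((\row_l \sum_i \sum_j
      2^-1 * (\sum_m invmx G l m * (T i j m + T j i m - T m i j))
        * a 0 i * b 0 j) *m G *m z^T) 0 0
  = 2^-1 * ((b *m (\sum_k a 0 k *: T k) *m z^T) 0 0
            + (a *m (\sum_k b 0 k *: T k) *m z^T) 0 0
            - (a *m (\sum_k z 0 k *: T k) *m b^T) 0 0).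
Proof.
move=> sG uG.
(* [T k] stands for the k-th partial derivative of the Gram matrix, so [K] is twice the Christoffel
   symbol of the first kind contracted with [a] and [b]. *)
pose K : 'cV[R]_n := \col_m \sum_i \sum_j
  a 0 i * b 0 j * (T i j m + T j i m - T m i j).
have -> : (\row_l \sum_i \sum_j
      2^-1 * (\sum_m invmx G l m * (T i j m + T j i m - T m i j))
        * a 0 i * b 0 j) = 2^-1 *: (invmx G *m K)^T.
  apply/rowP => l; rewrite !mxE mulr_sumr.
  under [RHS]eq_bigr do rewrite mxE mulr_sumr mulr_sumr.
  rewrite [RHS]exchange_big; apply: eq_bigr => i _ /=.
  under [RHS]eq_bigr do rewrite mulr_sumr mulr_sumr.
  rewrite [RHS]exchange_big; apply: eq_bigr => j _ /=.
  rewrite mulr_sumr !mulr_suml; apply: eq_bigr => m _.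
  by ring.
rewrite trmx_mul trmx_inv sG -!scalemxAl mulmxKV // mxE; congr (_ * _).
rewrite !trilinear_sum mxE.
have -> : \sum_k \sum_i \sum_j a 0 k * b 0 i * z 0 j * T k i j =
    \sum_m \sum_i \sum_j a 0 i * b 0 j * z 0 m * T i j m.
  rewrite [RHS]exchange_big; apply: eq_bigr => i _ /=.
  by rewrite exchange_big.
have -> : \sum_k \sum_i \sum_j b 0 k * a 0 i * z 0 j * T k i j =
    \sum_m \sum_i \sum_j a 0 i * b 0 j * z 0 m * T j i m.
  rewrite exchange_big [RHS]exchange_big; apply: eq_bigr => i _ /=.
  rewrite [RHS]exchange_big; apply: eq_bigr => j _ /=.
  by apply: eq_bigr => m _; ring.
rewrite -big_split -sumrB; apply: eq_bigr => m _ /=.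
rewrite !mxE mulr_suml -big_split -sumrB; apply: eq_bigr => i _ /=.
rewrite mulr_suml -big_split -sumrB; apply: eq_bigr => j _ /=.
by ring.
Qed.

End Christoffel.

(** * Tangent maps and the second fundamental form in charts *)

Section Charts.
Variable R : realType.

(** This and [differentiable_map] keep the first-order part of smoothness: it suffices for the chain
    rule on tangent vectors and passes directly to [time_product] and [cylinder]. *)
Definition compatible_atlas (n : nat) (M : charted R n) : Prop :=
  forall c c' : chart R M n, atlas c -> atlas c' ->
  forall y, ctarget c y -> csource c' (cinv c y) ->
    differentiable (c' \o cinv c) y.

Definition differentiable_map (k n : nat) (S : charted R k) (M : charted R n)
    (f : S -> M) : Prop :=
  continuous f /\
  forall (d : chart R S k) (c : chart R M n), atlas d -> atlas c ->
  forall y, ctarget d y -> csource c (f (cinv d y)) ->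
    differentiable (c \o f \o cinv d) y.

Lemma smooth_manifold_compatible (n : nat) (M : charted R n) :
  smooth_manifold M -> compatible_atlas M.
Proof. by case=> _ _ _ h c c' ac ac' y cy c'y; exact: (h c c' ac ac' [::]). Qed.

Lemma smooth_map_differentiable (k n : nat) (S : charted R k) (M : charted R n)
  (f : S -> M) : smooth_map f -> differentiable_map f.
Proof.
by case=> cf h; split=> // d c ad ac y dy cy; exact: (h d c ad ac [::]).
Qed.

Lemma near_cinv (n : nat) (T : topologicalType) (c : chart R T n)
    (U : set T) y :
  ctarget c y -> open U -> U (cinv c y) ->
  \forall z \near y, ctarget c z /\ U (cinv c z).
Proof.
move=> cy oU Uy; apply: filterI.
  by apply: open_nbhs_nbhs; split=> //; exact: ctarget_open.
by apply: (cinv_cont cy); exact: open_nbhs_nbhs.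
Qed.

Lemma jacobian_chart_id (n : nat) (T : topologicalType) (c : chart R T n) p :
  csource c p -> 'J (c \o cinv c) (c p) = 1%:M.
Proof.
move=> cp; apply: jacobian_id.
have := near_cinv (cmap_target cp) openT I.
by apply: filterS => z [cz _] /=; rewrite cinvK.
Qed.

Section OneManifold.
Variables (n : nat) (M : charted R n).

Lemma coord_field_chart_at (w : 'rV[R]_n) (p : M) :
  coord_field (chart_at p) w p = w.
Proof.
by rewrite /coord_field jacobian_chart_id ?mulmx1 //; exact: chart_at_source.
Qed.

Lemma gramE (g : tensor02 M) (c : chart R M n) y :
  let J := 'J (chart_at (cinv c y) \o cinv c) (c (cinv c y)) in
  gram g c y = J *m g (cinv c y) *m J^T.
Proof.
move=> J; apply/matrixP => i j; rewrite mxE /inner /coord_field -/J trmx_mul.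
by rewrite trmx_delta !mulmxA -colE mxE -!mulmxA -rowE mxE.
Qed.

Lemma gram_chart_at (g : tensor02 M) p :
  gram g (chart_at p) (chart_at p p) = g p.
Proof.
have cp := chart_at_source p.
by rewrite gramE cmapK // jacobian_chart_id // trmx1 mulmx1 mul1mx.
Qed.

End OneManifold.

Section Maps.
Variables (k n : nat) (S : charted R k) (M : charted R n) (f : S -> M).
Hypotheses (hS : compatible_atlas S) (hM : compatible_atlas M).
Hypothesis hf : differentiable_map f.

Lemma near_chart (d : chart R S k) (c : chart R M n) x :
  csource d x -> csource c (f x) ->
  \forall z \near d x, ctarget d z /\ csource c (f (cinv d z)).
Proof.
move=> dx cx; have [cf _] := hf.
apply: (@near_cinv _ _ d (f @^-1` csource c)); first exact: cmap_target.
  exact: (open_comp (fun y _ => cf y) (csource_open c)).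
by rewrite cmapK.
Qed.

(** By the chain rule, the transitions through the preferred charts at [x] and [f x] are absorbed
    into the Jacobian of [f] in the charts [d] and [c]. *)
Lemma tcoord_mdiff (d : chart R S k) (c : chart R M n) (x : S) (w : 'rV[R]_k) :
  atlas d -> atlas c -> csource d x -> csource c (f x) ->
  tcoord c (mdiff f (coord_field d w x)) = w *m 'J (c \o f \o cinv d) (d x).
Proof.
move=> ad ac dx cx; have [cf df] := hf.
rewrite /tcoord /mdiff /coord_field.
set d' := chart_at x; set c' := chart_at (f x).
have ad' : atlas d' := chart_at_atlas _.
have ac' : atlas c' := chart_at_atlas _.
have d'x : csource d' x := chart_at_source _.
have c'x : csource c' (f x) := chart_at_source _.
have dtd : differentiable (d' \o cinv d) (d x).
  by apply: hS; rewrite ?cmapK //; exact: cmap_target.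
have dtc : differentiable (c \o cinv c') (c' (f x)).
  by apply: hM; rewrite ?cmapK //; exact: cmap_target.
have df' : differentiable (c' \o f \o cinv d') (d' x).
  by apply: df; rewrite ?cmapK //; exact: cmap_target.
have e1 : (d' \o cinv d) (d x) = d' x by rewrite /= cmapK.
have e2 : (c' \o f \o cinv d') (d' x) = c' (f x) by rewrite /= cmapK.
pose h := (c' \o f \o cinv d') \o (d' \o cinv d).
have dh : differentiable h (d x) by apply: differentiable_comp; rewrite ?e1.
have eh : h (d x) = c' (f x) by rewrite -e2 -e1.
have J1 := jacobian_comp e1 dtd df'.
have J2 := jacobian_comp eh dh dtc.
rewrite -!mulmxA; congr (_ *m _).
rewrite mulmxA; transitivity ('J ((c \o cinv c') \o h) (d x)).
  by rewrite J2 J1.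
(* The detour through the preferred charts equals the direct expression only where those charts are
   defined, that is near [d x]. *)
apply: near_eq_jacobian; last by apply: differentiable_comp; rewrite ?eh.
have h1 := near_chart dx c'x.
have h2 := near_cinv (cmap_target dx) (csource_open d').
rewrite cmapK // in h2; have {}h2 := h2 d'x.
apply: filterS2 h1 h2 => z [_ c'z] [_ d'z] /=.
by rewrite /h /= (cmapK d'z) cmapK.
Qed.

(** By [tcoord_mdiff] the extension of [w] has components ['D_w (c \o f \o cinv d)] near [d x];
    differentiating along [v] leaves a second directional derivative. *)
Lemma cov_deriv_coord_field (g : tensor02 M) (x : S) (v w : 'rV[R]_k) :
  let c := chart_at (f x) in
  let d := chart_at x in
  cov_deriv g (fun x' => mdiff f (coord_field d w x')) (v : tangent x) =
  'D_v ('D_w (c \o f \o cinv d)) (d x) +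
   \row_l \sum_i \sum_j christoffel g c (c (f x)) l i j *
     (mdiff f (v : tangent x) : 'rV_n) 0 i *
     (mdiff f (w : tangent x) : 'rV_n) 0 j.
Proof.
move=> c d; rewrite /cov_deriv coord_field_chart_at -/c -/d.
apply: (congr1 (+%R^~ _)).
apply: near_eq_derive.
have cx : csource c (f x) := chart_at_source _.
have dx : csource d x := chart_at_source _.
have ac : atlas c := chart_at_atlas _.
have ad : atlas d := chart_at_atlas _.
apply: filterS (near_chart dx cx) => z [dz cz].
rewrite tcoord_mdiff //; last exact: cinv_source.
rewrite cinvK // deriveEjacobian //.
by have [_] := hf; apply.
Qed.

Lemma second_formE (g : tensor02 M) (x : S) (nu : tangent (f x))
    (v w : 'rV[R]_k) :
  let c := chart_at (f x) in
  let d := chart_at x in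
  let dG a := 'D_a (gram g c) (c (f x)) in
  let a : 'rV_n := mdiff f (v : tangent x) in
  let b : 'rV_n := mdiff f (w : tangent x) in
  (g (f x))^T = g (f x) -> g (f x) \in unitmx ->
  differentiable (gram g c) (c (f x)) ->
  second_form g nu (v : tangent x) w =
  - (('D_v ('D_w (c \o f \o cinv d)) (d x) *m g (f x) *m nu^T) 0 0
     + 2^-1 * ((b *m dG a *m nu^T) 0 0 + (a *m dG b *m nu^T) 0 0
               - (a *m dG nu *m b^T) 0 0)).
Proof.
move=> c d dG a b sG uG dGd; rewrite /second_form cov_deriv_coord_field /inner.
congr (- _); rewrite -/c -/d !mulmxDl mxE; congr (_ + _).
(* Linearity in the direction turns the contractions of partial derivatives in [christoffel_lower]
   into directional derivatives of the Gram matrix. *)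
have dGE (u : 'rV[R]_n) : dG u = \sum_i u 0 i *: dG (delta_mx 0 i).
  rewrite /dG deriveE // [in LHS](row_sum_delta u) linear_sum.
  by apply: eq_bigr => i _; rewrite linearZ deriveE.
rewrite !(dGE a) (dGE b) (dGE nu) -(christoffel_lower _ _ _ _ sG uG).
congr ((_ *m _ *m _) 0 0); apply/rowP => l; rewrite !mxE.
apply: eq_bigr => i _; apply: eq_bigr => j _; congr (_ * _ * _).
rewrite /christoffel -/c gram_chart_at; congr (_ * _).
by apply: eq_bigr => m _; congr (_ * (_ + _ - _)); rewrite derive_mx_coord.
Qed.

End Maps.
End Charts.

(** * Block diagonal matrices and their derivatives *)

Section BlockMatrices.
Variable R : realType.

(** Exhibits the block matrix as a sum of linear images of [A] and [B], the form needed to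
    differentiate it. *)
Lemma block_diagE (n : nat) (A : 'M[R]_1) (B : 'M[R]_n) :
  block_mx A 0 0 B =
    (col_mx 1%:M 0 : 'M[R]_(1 + n, 1)) *m A
      *m (row_mx 1%:M 0 : 'M[R]_(1, 1 + n))
    + (col_mx 0 1%:M : 'M[R]_(1 + n, n)) *m B
      *m (row_mx 0 1%:M : 'M[R]_(n, 1 + n)).
Proof.
rewrite !mul_col_mx !mul_mx_row !mul1mx !mul0mx !mulmx1 !mulmx0.
by rewrite add_col_mx !add_row_mx !addr0 !add0r.
Qed.

Lemma block_diag_form (n : nat) (A : 'M[R]_1) (B : 'M[R]_n)
    (p q : 'M[R]_1) (a b : 'rV[R]_n) :
  row_mx p a *m block_mx A 0 0 B *m (row_mx q b)^T =
  p *m A *m q^T + a *m B *m b^T.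
Proof.
by rewrite mul_row_block !mulmx0 addr0 add0r tr_row_mx mul_row_col.
Qed.

(** The algebra behind [second_form_cylinder]. The normal has no time component, so the time entries
    [X], [Y], [Z] drop out; only the derivative of -N^2 along the normal meets [s] and [t]. *)
Lemma block_second_form (n : nat) (N dN : R) (X Y Z s t : 'M[R]_1)
    (G Da Db Dn : 'M[R]_n) (dd a b nu : 'rV[R]_n) :
  - ((row_mx 0 dd *m block_mx X 0 0 G *m (row_mx 0 nu)^T) 0 0
     + 2^-1 * ((row_mx t b *m block_mx Y 0 0 Da *m (row_mx 0 nu)^T) 0 0
               + (row_mx s a *m block_mx Z 0 0 Db *m (row_mx 0 nu)^T) 0 0
               - (row_mx s a *m block_mx (- (2 * N * dN))%:M 0 0 Dn
                    *m (row_mx t b)^T) 0 0))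
  = - ((dd *m G *m nu^T) 0 0
       + 2^-1 * ((b *m Da *m nu^T) 0 0 + (a *m Db *m nu^T) 0 0
                 - (a *m Dn *m b^T) 0 0))
    - N * dN * s 0 0 * t 0 0.
Proof.
rewrite !block_diag_form !trmx0 !mulmx0 !add0r.
have -> : (s *m (- (2 * N * dN))%:M *m t^T + a *m Dn *m b^T) 0 0
    = - (2 * N * dN) * (s 0 0 * t 0 0) + (a *m Dn *m b^T) 0 0.
  by rewrite mxE mul_mx_scalar -scalemxAl !mxE big_ord1 !mxE.
by field.
Qed.

Section Differentiation.
Variables (V : normedModType R) (n : nat).
Variables (A : V -> 'M[R]_1) (B : V -> 'M[R]_n) (x : V).
Hypotheses (dA : differentiable A x) (dB : differentiable B x).

Let block_diagfE : (fun y => block_mx (A y) 0 0 (B y)) =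
  (fun y => (mulmx (col_mx 1%:M 0 : 'M[R]_(1 + n, 1))
               \o mulmxr (row_mx 1%:M 0 : 'M[R]_(1, 1 + n))) (A y))
  + (fun y => (mulmx (col_mx 0 1%:M : 'M[R]_(1 + n, n))
               \o mulmxr (row_mx 0 1%:M : 'M[R]_(n, 1 + n))) (B y)).
Proof. by apply/funext => y; rewrite block_diagE !fctE /= !mulmxA. Qed.

Lemma differentiable_block_diag :
  differentiable (fun y => block_mx (A y) 0 0 (B y)) x.
Proof.
rewrite block_diagfE.
by apply: differentiableD; apply: differentiable_linear_mx.
Qed.

Lemma derive_block_diag v :
  'D_v (fun y => block_mx (A y) 0 0 (B y)) x
  = block_mx ('D_v A x) 0 0 ('D_v B x).
Proof.
rewrite block_diagfE deriveD; last 2 first.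
- exact/diff_derivable/differentiable_linear_mx.
- exact/diff_derivable/differentiable_linear_mx.
by rewrite !derive_linear_mx // block_diagE /= !mulmxA.
Qed.

End Differentiation.

(** A nonzero kernel vector would have length zero. *)
Lemma posdef_unitmx (n : nat) (G : 'M[R]_n) :
  (forall v : 'rV[R]_n, v != 0 -> 0 < (v *m G *m v^T) 0 0) -> G \in unitmx.
Proof.
move=> pG; rewrite -row_free_unit -kermx_eq0; apply: contraT => /rowV0Pn[v].
by move=> /sub_kermxP vG /pG; rewrite vG mul0mx mxE ltxx.
Qed.

End BlockMatrices.

(** * Charts of R x M and the cylinder map *)

Section TimeProductCharts.
Variables (R : realType) (k n : nat) (S : charted R k) (M : charted R n).
Implicit Types (c : chart R M n) (d : chart R S k) (f : S -> M).

Lemma time_chart_transition c c' :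
  time_chart c' \o cinv (time_chart c) = lift_time (c' \o cinv c).
Proof.
by apply/funext => y; congr row_mx; apply/matrixP => i j; rewrite mxE !ord1.
Qed.

Lemma time_chart_cylinder f d c :
  time_chart c \o cylinder f \o cinv (time_chart d)
  = lift_time (c \o f \o cinv d).
Proof.
by apply/funext => y; congr row_mx; apply/matrixP => i j; rewrite mxE !ord1.
Qed.

Lemma compatible_time_product :
  compatible_atlas M -> compatible_atlas (time_product M).
Proof.
move=> hM _ _ [c ac <-] [c' ac' <-] y cy c'y.
by rewrite time_chart_transition; apply: differentiable_lift_time; exact: hM.
Qed.

Lemma differentiable_cylinder f :
  differentiable_map f -> differentiable_map (cylinder f).
Proof.
move=> [cf df]; split.
  move=> q; have c1 : {for q, continuous (@fst R S)} by exact: cvg_fst.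
  have c2 : {for q, continuous (f \o @snd R S)}.
    by apply: continuous_comp; [exact: cvg_snd | exact: cf].
  exact: (cvg_pair c1 c2).
move=> _ _ [d ad <-] [c ac <-] y dy cy.
by rewrite time_chart_cylinder; apply: differentiable_lift_time; exact: df.
Qed.

Lemma mdiff_cylinder f (q : time_product S) (tau : 'M[R]_1) (v : 'rV[R]_k) :
  differentiable_map f ->
  mdiff (cylinder f) (row_mx tau v : tangent q)
  = row_mx tau (mdiff f (v : tangent q.2)).
Proof.
move=> [_ df]; rewrite /mdiff time_chart_cylinder jacobian_lift_time /=.
  by rewrite row_mxKr mul_row_block !mulmx0 mulmx1 addr0 add0r.
rewrite row_mxKr; apply: df; try exact: chart_at_atlas.
  by apply: cmap_target; exact: chart_at_source.
by rewrite cmapK; exact: chart_at_source.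
Qed.

(** The time component of the first derivative is the constant [lsubmx w], hence the zero block. *)
Lemma derive2_lift_time (phi : 'rV[R]_k -> 'rV[R]_n) y v w :
  (\forall z \near rsubmx y, differentiable phi z) ->
  differentiable ('D_(rsubmx w) phi) (rsubmx y) ->
  'D_v ('D_w (lift_time phi)) y
  = row_mx 0 ('D_(rsubmx v) ('D_(rsubmx w) phi) (rsubmx y)).
Proof.
move=> dphi ddphi.
pose F (z : 'rV[R]_(1 + k)) : 'rV[R]_(1 + n) :=
  'D_(rsubmx w) phi (rsubmx z) *m row_mx 0 1%:M.
transitivity ('D_v (cst (row_mx (lsubmx w) 0) + F) y).
  apply: near_eq_derive.
  have cr : {for y, continuous (@rsubmx R 1 1 k)} by exact: continuous_rsubmx.
  have ndphi : \forall z \near y, differentiable phi (rsubmx z) := cr _ dphi.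
  apply: filterS ndphi => z dz; rewrite derive_lift_time // !fctE /F.
  by rewrite mul_mx_row mulmx0 mulmx1 add_row_mx addr0 add0r.
have dF : differentiable F y.
  apply: (differentiable_linear_mx (mulmxr _)).
  exact: (differentiable_comp_rsubmx ddphi).
rewrite deriveD; [|exact: derivable_cst|exact: diff_derivable].
rewrite derive_cst add0r /F (derive_linear_mx (mulmxr _)); last first.
  exact: (differentiable_comp_rsubmx ddphi).
rewrite (derive_comp_rsubmx ('D_(rsubmx w) phi)) /=.
by rewrite mul_mx_row mulmx0 mulmx1.
Qed.

End TimeProductCharts.

(** * The static metric in coordinates and the second fundamental form of a cylinder *)

Section StaticMetric.
Variables (R : realType) (n : nat) (M : charted R n).
Variables (N : M -> R) (g : tensor02 M).
Hypothesis hL : static_spacetime N g.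

Lemma differentiable_lapse (c : chart R M n) y :
  atlas c -> ctarget c y -> differentiable (N \o cinv c) y.
Proof. by case: hL => _ _ sN _ ac cy; exact: (sN c ac [::]). Qed.

Lemma differentiable_gram (c : chart R M n) y :
  atlas c -> ctarget c y -> differentiable (gram g c) y.
Proof.
case: hL => _ [sg _ _] _ _ ac cy; apply: differentiable_mx => i j.
exact: (sg c ac i j [::]).
Qed.

Lemma unitmx_metric p : g p \in unitmx.
Proof. by case: hL => _ [_ _ pg] _ _; apply: posdef_unitmx => v; exact: pg. Qed.

Lemma unitmx_static_metric q : static_metric N g q \in unitmx.
Proof.
case: hL => _ _ _ N0; rewrite unitmxE det_ublock unitrM -!unitmxE.
rewrite unitmx_metric.
rewrite andbT unitmxE det_scalar unitfE.
by rewrite expr1 oppr_eq0 sqrf_eq0 gt_eqF.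
Qed.

Lemma static_metric_sym q : (static_metric N g q)^T = static_metric N g q.
Proof.
case: hL => _ [_ sg _] _ _.
by rewrite /static_metric tr_block_mx tr_scalar_mx !trmx0 sg.
Qed.

(** Transitions between product charts have Jacobian diag(1, J), and congruence by such a matrix
    leaves the time entry alone. *)
Lemma gram_static_metric (c : chart R M n) (y : 'rV[R]_(1 + n)) :
  atlas c -> ctarget c (rsubmx y) ->
  gram (static_metric N g) (time_chart c) y =
  block_mx (- N (cinv c (rsubmx y)) ^+ 2)%:M 0 0 (gram g c (rsubmx y)).
Proof.
case: hL => sM _ _ _ ac cy; have hM := smooth_manifold_compatible sM.
rewrite !gramE time_chart_transition jacobian_lift_time; last first.
  rewrite /= row_mxKr cinvK //; apply: hM => //; first exact: chart_at_atlas.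
  exact: chart_at_source.
rewrite tr_block_mx !trmx0 trmx1 /static_metric !mulmx_block.
by rewrite !mulmx0 !mul0mx !addr0 !add0r !mulmx1 !mul1mx mul0mx /= row_mxKr.
Qed.

Let lapse2 (c : chart R M n) (y : 'rV[R]_n) : 'M[R]_1 :=
  (- N (cinv c y) ^+ 2)%:M.

Lemma differentiable_lapse2 (c : chart R M n) y :
  atlas c -> ctarget c y -> differentiable (lapse2 c) y.
Proof.
move=> ac cy; apply: differentiable_mx => i j.
have -> : (fun z => lapse2 c z i j) = - (N \o cinv c) ^+ 2.
  by apply/funext => z; rewrite !ord1 mxE eqxx mulr1n.
by apply: differentiableN; apply: differentiableX; exact: differentiable_lapse.
Qed.

Lemma derive_lapse2 (c : chart R M n) y v :
  atlas c -> ctarget c y ->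
  'D_v (lapse2 c) y = (- (2 * N (cinv c y) * 'D_v (N \o cinv c) y))%:M.
Proof.
move=> ac cy; have dN := differentiable_lapse ac cy.
have dv : derivable (N \o cinv c) y v by exact: diff_derivable.
apply/matrixP => i j; rewrite -derive_mx_coord;
  last exact: differentiable_lapse2.
have -> : (fun z => lapse2 c z i j) = - (N \o cinv c) ^+ 2.
  by apply/funext => z; rewrite !ord1 mxE eqxx mulr1n.
rewrite deriveN; last exact: derivableX.
by rewrite deriveX // !ord1 mxE eqxx mulr1n; congr (- _).
Qed.

(** The coefficients are independent of t, so only the spatial part of the direction counts. *)
Lemma derive_gram_static_metric (p : time_product M) (v : 'rV[R]_(1 + n)) :
  let c := chart_at p.2 in
  let G := gram (static_metric N g) (chart_at p) in
  differentiable G (chart_at p p) /\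
  'D_v G (chart_at p p) =
    block_mx (- (2 * N p.2 * vderiv N (rsubmx v : tangent p.2)))%:M 0
             0 ('D_(rsubmx v) (gram g c) (c p.2)).
Proof.
move=> c G; have cp : csource c p.2 := chart_at_source _.
have ac : atlas c := chart_at_atlas _.
pose G' (y : 'rV[R]_(1 + n)) : 'M[R]_(1 + n) :=
  block_mx (lapse2 c (rsubmx y)) 0 0 (gram g c (rsubmx y)).
have rp : rsubmx (chart_at p p : 'rV[R]_(1 + n)) = c p.2 by rewrite /= row_mxKr.
have cp' : ctarget c (rsubmx (chart_at p p : 'rV[R]_(1 + n))).
  by rewrite rp; exact: cmap_target.
have GG' : \forall y \near chart_at p p, G' y = G y.
  have := near_cinv (cmap_target (chart_at_source p)) openT I.
  by apply: filterS => y [cy _]; exact/esym/(gram_static_metric ac cy).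
have dA := differentiable_comp_rsubmx (differentiable_lapse2 ac cp').
have dB := differentiable_comp_rsubmx (differentiable_gram ac cp').
have dG' : differentiable G' (chart_at p p) := differentiable_block_diag dA dB.
split; first exact: near_eq_differentiable GG' dG'.
rewrite -(near_eq_derive _ GG') (derive_block_diag dA dB).
rewrite (derive_comp_rsubmx (lapse2 c)) (derive_comp_rsubmx (gram g c)).
rewrite (derive_lapse2 _ ac cp') rp (cmapK cp).
reflexivity.
Qed.

Section SecondForm.
Variables (k : nat) (S : charted R k) (f : S -> M).
Hypotheses (sS : smooth_manifold S) (sf : smooth_map f).
Variables (q : time_product S) (nu : 'rV[R]_n).

Let hS := smooth_manifold_compatible sS.
Let hM : compatible_atlas M.
Proof. by case: hL => sM _ _ _; exact: smooth_manifold_compatible. Qed.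
Let hf := smooth_map_differentiable sf.

(** [second_formE] is applied to the slice and to the cylinder; [derive2_lift_time] and the block
    form of the Gram derivatives reduce the comparison to [block_second_form]. *)
Lemma second_form_cylinder (s t : 'M[R]_1) (v w : 'rV[R]_k) :
  second_form (static_metric N g) (row_mx 0 nu : tangent (cylinder f q))
    (row_mx s v : tangent q) (row_mx t w)
  = second_form g (nu : tangent (f q.2)) (v : tangent q.2) w
    - N (f q.2) * vderiv N (nu : tangent (f q.2)) * s 0 0 * t 0 0.
Proof.
set x := q.2; set c := chart_at (f x); set d := chart_at x.
have dx : csource d x := chart_at_source _.
have cx : csource c (f x) := chart_at_source _.
have ad : atlas d := chart_at_atlas _.
have ac : atlas c := chart_at_atlas _.
have sg : (g (f x))^T = g (f x) by case: hL => _ [_ ? _].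
have ug := unitmx_metric (f x).
have dg := differentiable_gram ac (cmap_target cx).
rewrite (second_formE hS hM hf nu v w sg ug dg).
have [dG _] := derive_gram_static_metric (cylinder f q) 0.
rewrite (second_formE (compatible_time_product hS) (compatible_time_product hM)
  (differentiable_cylinder hf) _ _ _ (static_metric_sym _)
  (unitmx_static_metric _) dG).
rewrite !mdiff_cylinder // -/x -/c -/d.
have dphi : \forall z \near d x, differentiable (c \o f \o cinv d) z.
  have [_ df] := hf; apply: filterS (near_chart hf dx cx) => z [dz cz].
  exact: df.
have ddphi u : differentiable ('D_u (c \o f \o cinv d)) (d x).
  have [_ sf'] := sf; apply: (sf' d c ad ac [:: u]).
  split; first exact: cmap_target.
  by rewrite /preimage /= (cmapK dx).
have rq : rsubmx (chart_at q q : 'rV[R]_(1 + k)) = d x by rewrite /= row_mxKr.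
rewrite time_chart_cylinder derive2_lift_time; last 2 first.
- by rewrite rq; exact: dphi.
- by rewrite rq; exact: ddphi.
rewrite rq.
rewrite !(derive_gram_static_metric (cylinder f q) _).2.
rewrite !row_mxKr.
exact: block_second_form.
Qed.

End SecondForm.
End StaticMetric.

(** * Normal splitting, traces of umbilic forms, and a sign argument *)

Section Umbilic.
Variable R : realType.

Lemma bilinear_sym (n : nat) (G : 'M[R]_n) (u v : 'rV[R]_n) :
  G^T = G -> (u *m G *m v^T) 0 0 = (v *m G *m u^T) 0 0.
Proof.
move=> sG; rewrite -[in RHS]sG -[in RHS](trmxK v) -!trmx_mul.
by rewrite [RHS]mxE mulmxA.
Qed.

(** The rows of [A] lie in the orthogonal complement of [nu] and, being n - 1 independent vectors,
    fill it. *)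
Lemma normal_decomposition (n : nat) (A : 'M[R]_(n.-1, n)) (G : 'M[R]_n)
    (nu u : 'rV[R]_n) :
  row_free A -> A *m G *m nu^T = 0 -> (nu *m G *m nu^T) 0 0 = 1 ->
  exists v : 'rV_n.-1, u = (u *m G *m nu^T) 0 0 *: nu + v *m A.
Proof.
move=> fA AG nuG; set B := G *m nu^T.
have nB : nu *m B = 1%:M.
  by apply/matrixP => i j; rewrite !ord1 /B mulmxA nuG mxE eqxx.
have rB : \rank B = 1%N.
  apply/eqP; rewrite eqn_leq rank_leq_col lt0n mxrank_eq0.
  apply: contraTneq (oner_neq0 R) => B0.
  by rewrite -nuG -mulmxA -/B B0 mulmx0 mxE eqxx.
have AB : (A <= kermx B)%MS by rewrite sub_kermx /B mulmxA AG.
(* [B] has rank 1, so its kernel has dimension n - 1, the rank of [A]; the inclusion is an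
   equality. *)
have /geq_leqif := mxrank_leqif_eq AB.
rewrite mxrank_ker rB subn1 (eqP fA) leqnn => /esym /eqmxP kA.
have /submxP[v uv] : (u - (u *m G *m nu^T) 0 0 *: nu <= A)%MS.
  rewrite kA sub_kermx mulmxBl -scalemxAl nB -mulmxA -/B.
  by rewrite [X in X - _]mx11_scalar scalemx1 subrr.
by exists v; rewrite -uv addrC subrK.
Qed.

Variables (k n : nat) (S : charted R k) (M : charted R n).
Variables (g : tensor02 M) (f : S -> M).

Lemma inner_induced (x : S) (v w : 'rV[R]_k) :
  inner (Defs.induced g f) (v : tangent x) w =
  inner g (mdiff f (v : tangent x)) (mdiff f (w : tangent x)).
Proof.
set J := 'J (chart_at (f x) \o f \o cinv (chart_at x)) (chart_at x x).
have -> : inner (Defs.induced g f) (v : tangent x) w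
    = (v *m (J *m g (f x) *m J^T) *m w^T) 0 0.
  congr ((_ *m _ *m _) 0 0); apply/matrixP => i j.
  rewrite mxE /inner /mdiff -/J trmx_mul trmx_delta.
  by rewrite !mulmxA -colE mxE -!mulmxA -rowE mxE.
by rewrite /inner /mdiff -/J trmx_mul !mulmxA.
Qed.

(** The matrix under the trace is lambda times the identity of size [k]. *)
Lemma umbilic_mean_curvature (x : S) (nu : tangent (f x)) (lambda : R) :
  Defs.induced g f x \in unitmx ->
  (forall v w : tangent x,
     second_form g nu v w = lambda * inner (Defs.induced g f) v w) ->
  mean_curvature g f nu = lambda * k%:R.
Proof.
move=> uI um; rewrite /mean_curvature.
have -> : \matrix_(i, j) second_form g nu
    (delta_mx 0 i : tangent x) (delta_mx 0 j) = lambda *: Defs.induced g f x.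
  apply/matrixP => i j; rewrite mxE um [RHS]mxE; congr (_ * _).
  by rewrite /inner trmx_delta -rowE -colE !mxE.
by rewrite -scalemxAr mulVmx // linearZ /= mxtrace1.
Qed.

Lemma unitmx_timelike (x : S) : timelike g f -> Defs.induced g f x \in unitmx.
Proof.
move=> /(_ x)[A uA AE]; have : A *m Defs.induced g f x *m A^T \in unitmx.
  rewrite AE unitmxE det_diag unitfE; apply/prodf_neq0 => i _; rewrite mxE.
  by case: ifP => _; rewrite ?oppr_eq0 oner_eq0.
by rewrite !unitmx_mul => /andP[/andP[]].
Qed.

Lemma unitmx_immersion (x : S) :
  (forall v : tangent (f x), v != 0 :> 'rV_n -> 0 < inner g v v) ->
  (forall v : tangent x, mdiff f v = 0 -> v = 0) ->
  Defs.induced g f x \in unitmx.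
Proof.
move=> pg inj; apply: posdef_unitmx => v v0.
have := inner_induced x v v; rewrite {1}/inner => ->.
by apply: pg; apply: contra_neq v0; exact: inj.
Qed.

(** Opposite values at [s] and [t] would force a zero in between. *)
Lemma continuous_sqr_eq (h : R -> R) :
  continuous h -> (forall t, h t != 0) ->
  forall s t, h s ^+ 2 = h t ^+ 2 -> h s = h t.
Proof.
move=> ch h0 s t; wlog st : s t / s <= t => [hw|].
  by case: (leP s t) => [|/ltW] st e; [|apply/esym]; apply: hw.
move/eqP; rewrite eqf_sqr => /orP[/eqP //|/eqP hst].
have [||c _ hc] := @IVT R h s t 0 st.
- by move=> z; exact: continuous_subspaceT.
(* Since [h s = - h t], zero lies between the end values whichever sign [h t] has. *)
- rewrite hst; case: (leP 0 (h t)) => ht.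
    by rewrite min_l ?max_r ?oppr_le0 ?ht // (le_trans _ ht) // oppr_le0.
  have ht' := ltW ht.
  by rewrite min_r ?max_l ?oppr_ge0 ?ht' // (le_trans ht') // oppr_ge0.
by move: (h0 c); rewrite hc eqxx.
Qed.

End Umbilic.

(** * Derivatives of a function along tangent vectors *)

Section VectorDerivation.
Variables (R : realType) (k n : nat) (S : charted R k) (M : charted R n).
Variables (N : M -> R).
Hypothesis sN : smooth_fun N.

Lemma differentiable_smooth_fun p : 
  differentiable (N \o cinv (chart_at p)) (chart_at p p).
Proof.
by apply: (sN (chart_at_atlas p) [::]); exact/cmap_target/chart_at_source.
Qed.

Lemma vderivD p (u v : 'rV[R]_n) (a : R) :
  vderiv N (a *: u + v : tangent p) =
  a * vderiv N (u : tangent p) + vderiv N (v : tangent p).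
Proof.
have dN := differentiable_smooth_fun p.
by rewrite /vderiv !deriveE // linearD linearZ.
Qed.

(** Chain rule: the chart expressions of [N] and [f] compose to a function that is constant near
    [d x]. *)
Lemma vderiv_level (f : S -> M) a x (v : 'rV[R]_k) :
  differentiable_map f -> (forall y, N (f y) = a) ->
  vderiv N (mdiff f (v : tangent x)) = 0.
Proof.
move=> hf Na; have [_ df] := hf.
set c := chart_at (f x); set d := chart_at x.
have dx : csource d x := chart_at_source _.
have cx : csource c (f x) := chart_at_source _.
have near_x := near_chart hf dx cx.
have dphi : differentiable (c \o f \o cinv d) (d x).
  have [dy cy] := nbhs_singleton near_x.
  by apply: df => //; exact: chart_at_atlas.
have e : (c \o f \o cinv d) (d x) = c (f x) by rewrite /= (cmapK dx).
have dN := differentiable_smooth_fun (f x).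
rewrite /vderiv /mdiff -/c -/d -(deriveEjacobian v dphi) -[in LHS]e.
rewrite -derive_comp ?e // -[RHS](derive_cst a (d x) v).
apply: near_eq_derive; apply: filterS near_x => z [dz cz] /=.
by rewrite (cmapK cz) Na.
Qed.

Lemma vderiv_static_fun (q : time_product M) (v : 'rV[R]_(1 + n)) :
  vderiv (static_fun N) (v : tangent q) = vderiv N (rsubmx v : tangent q.2).
Proof.
rewrite /vderiv (derive_comp_rsubmx (N \o cinv (chart_at q.2))).
by rewrite /= row_mxKr.
Qed.

End VectorDerivation.

(** * The normal, the umbilic factor and the mean curvatures of a photon sphere *)

Section PhotonSphere.
Variables (R : realType) (n : nat) (M : charted R n).
Variables (N : M -> R) (g : tensor02 M).
Variables (S : charted R n.-1) (f : S -> M).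
Variable eta : forall q : time_product S, tangent (cylinder f q).
Hypotheses (hn : (0 < n)%N) (hL : static_spacetime N g).
Hypotheses (hP : photon_sphere N g f) (hnd : non_degenerate N f).
Hypothesis heta : unit_normal (static_metric N g) eta.

Let nu := slice_normal eta.

Let sS : smooth_manifold S. Proof. by case: hP => -[]. Qed.
Let sf : smooth_map f. Proof. by case: hP => -[_ []]. Qed.
Let hf : differentiable_map f := smooth_map_differentiable sf.
Let sN : smooth_fun N. Proof. by case: hL. Qed.

(** Orthogonality to d_t says that -N^2 times the time component vanishes, and N > 0. *)
Lemma normal_spatial q : eta q = row_mx 0 (nu q.1 q.2) :> 'rV_(1 + n).
Proof.
case: q => t x; have [_ /(_ (row_mx 1%:M 0 : 'rV_(1 + n.-1)))] := heta.2 (t, x).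
rewrite mdiff_cylinder // [mdiff f _]mul0mx /inner /nu /slice_normal.
set e : 'rV[R]_(1 + n) := eta (t, x).
rewrite -{1}(hsubmxK e) block_diag_form trmx0 !mulmx0 addr0 trmx1 mulmx1.
rewrite mul_mx_scalar mxE => /eqP; rewrite mulf_eq0 oppr_eq0 sqrf_eq0.
have [_ _ _ /(_ (f x)) N0] := hL; rewrite (gt_eqF N0) /= => /eqP e0.
rewrite -[LHS]hsubmxK; congr row_mx.
by apply/matrixP => i j; rewrite !ord1 e0 mxE.
Qed.

Lemma slice_normal_unit t x : unit_normal_at g (nu t x).
Proof.
have [nn nt] := heta.2 (t, x); have e := normal_spatial (t, x); split.
  by move: nn; rewrite /inner e block_diag_form !mul0mx add0r.
move=> v; have := nt (row_mx 0 v : 'rV_(1 + n.-1)).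
by rewrite mdiff_cylinder // /inner e block_diag_form !mul0mx add0r.
Qed.

(** Split [u] into normal and tangential parts; dN kills the latter by [vderiv_level]. *)
Lemma vderiv_normal_decomposition t x (u : 'rV[R]_n) :
  vderiv N (u : tangent (f x)) =
  inner g (u : tangent (f x)) (nu t x) * vderiv N (nu t x).
Proof.
have [nn nt] := slice_normal_unit t x.
have [[_ [_ inj _ _]] _ _ [a Na]] := hP.
set J := 'J (chart_at (f x) \o f \o cinv (chart_at x)) (chart_at x x).
(* A row in the kernel of [J] is a tangent vector killed by [mdiff f], hence zero for an
   immersion. *)
have fJ : row_free J.
  rewrite -kermx_eq0; apply/eqP/row_matrixP => i; rewrite row0.
  by apply: (inj x); rewrite /mdiff -/J -row_mul mulmx_ker row0.
have [_ [_ sg _] _ _] := hL.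
have JG : J *m g (f x) *m (nu t x)^T = 0.
  apply/row_matrixP => i; rewrite row0 !row_mul; apply/rowP => j.
  rewrite ord1 [RHS]mxE bilinear_sym // rowE.
  exact: (nt (delta_mx 0 i)).
have [v ->] := normal_decomposition u fJ JG nn.
have Nfa y : N (f y) = a := Na (0, y).
rewrite [LHS](vderivD sN (f x) (nu t x) (v *m J)).
have -> : vderiv N (v *m J : tangent (f x)) = 0.
  exact: (@vderiv_level R n.-1 n S M N sN f a x v hf Nfa).
rewrite addr0 /inner; congr (_ * _).
rewrite mulmxDl mulmxDl -!scalemxAl -(mulmxA v) -(mulmxA v) JG mulmx0 addr0.
by rewrite /inner in nn; rewrite [RHS]mxE nn mulr1.
Qed.

Lemma vderiv_normal_neq0 t x : vderiv N (nu t x) != 0.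
Proof.
have [v vN] := hnd (t, x); apply: contraNneq vN => e; apply/eqP.
rewrite vderiv_static_fun.
have -> := @vderiv_normal_decomposition t x (rsubmx (v : 'rV_(1 + n))).
by rewrite e mulr0.
Qed.

(** Decomposing each normal along the other, both squares equal the symmetric product g(nu_s, nu_t)
    nu_s(N) nu_t(N). *)
Lemma vderiv_normal_sqr s t x : vderiv N (nu s x) ^+ 2 = vderiv N (nu t x) ^+ 2.
Proof.
have [_ [_ sg _] _ _] := hL.
have e1 := vderiv_normal_decomposition t x (nu s x).
have e2 := vderiv_normal_decomposition s x (nu t x).
have sym : inner g (nu s x) (nu t x) = inner g (nu t x) (nu s x).
  exact: bilinear_sym.
by rewrite expr2 {1}e1 mulrAC sym -e2 expr2.
Qed.

(** Smoothness of [eta] concerns components in a fixed chart. Along t |-> (t, x) the preferred chart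
    is one and the same product chart, so these are the components of [eta] itself. *)
Lemma continuous_normal x :
  continuous (fun t : R => eta (t, x) : 'rV[R]_(1 + n)).
Proof.
have dx : csource (chart_at x) x := chart_at_source _.
have cx : csource (chart_at (f x)) (f x) := chart_at_source _.
pose c := time_chart (chart_at (f x)); pose d := time_chart (chart_at x).
pose E (q : time_product S) : 'rV[R]_(1 + n) :=
  tcoord (M := time_product M) c (eta q).
pose y (t : R) : 'rV[R]_(1 + n.-1) := d (t, x).
have yE t : cinv d (y t) = (t, x).
  by rewrite /y; apply: (@cmapK _ _ _ d).
have -> : (fun t : R => eta (t, x) : 'rV[R]_(1 + n)) = (E \o cinv d) \o y.
  apply/funext => t; rewrite -[RHS]/(E (cinv d (y t))) yE /E /tcoord.
  rewrite -[LHS]mulmx1; congr (_ *m _); apply/esym.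
  exact: (@jacobian_chart_id R _ _ c (t, f x)).
move=> t; apply: continuous_comp.
  have -> : y = (fun t => t *: row_mx 1%:M 0 + row_mx 0 (chart_at x x)).
    apply/funext => s; rewrite scale_row_mx scaler0 add_row_mx addr0 add0r.
    by congr row_mx; apply/matrixP => i j; rewrite !ord1 !mxE eqxx mulr1.
  apply: cvgD; last exact: cvg_cst.
  by apply: cvgZr_tmp; exact: cvg_id.
apply: differentiable_continuous.
have [sE _] := heta.
have ad : @atlas R (1 + n.-1) (time_product S) d.
  by exists (chart_at x) => //; exact: chart_at_atlas.
have ac : @atlas R (1 + n) (time_product M) c.
  by exists (chart_at (f x)) => //; exact: chart_at_atlas.
apply: (sE d c ad ac [::] (y t)); split.
  exact: (@cmap_target _ _ _ d (t, x)).
have : csource c (cylinder f (cinv d (y t))) by rewrite yE; exact: cx.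
exact.
Qed.

Lemma vderiv_normal_cst s t x : vderiv N (nu s x) = vderiv N (nu t x).
Proof.
apply: (@continuous_sqr_eq R (fun t => vderiv N (nu t x))).
- move=> u; have dN := differentiable_smooth_fun sN (f x).
  have -> : (fun t => vderiv N (nu t x)) =
      'd (N \o cinv (chart_at (f x))) (chart_at (f x) (f x))
        \o rsubmx \o (fun t : R => eta (t, x) : 'rV[R]_(1 + n)).
    by apply/funext => r; rewrite /= /vderiv deriveE.
  apply: continuous_comp; first exact: continuous_normal.
  apply: continuous_comp; first exact: continuous_rsubmx.
  exact: (diff_continuous dN).
- by move=> r; exact: vderiv_normal_neq0.
- exact: vderiv_normal_sqr.
Qed.

Lemma photon_sphere_umbilic q (v w : tangent q) :
  second_form (static_metric N g) (eta q) v w =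
  vderiv N (nu q.1 q.2) / N (f q.2)
    * inner (Defs.induced (static_metric N g) (cylinder f)) v w.
Proof.
have [_ _ /(_ q (eta q) (heta.2 q))[lambda um] _] := hP.
have [_ _ _ /(_ (f q.2)) N0] := hL.
rewrite um; congr (_ * _).
(* Umbilicity is tested on the multiple s d_t, whose induced square length is -N^2 s^2. *)
have slice (s : 'M[R]_1) : second_form (static_metric N g) (eta q)
   (row_mx s 0 : 'rV_(1 + n.-1)) (row_mx s 0 : 'rV_(1 + n.-1))
   = - (lambda * N (f q.2) ^+ 2 * s 0 0 ^+ 2).
  rewrite um inner_induced mdiff_cylinder // [mdiff f _]mul0mx /inner.
  rewrite block_diag_form mul0mx mul0mx addr0 mul_mx_scalar -scalemxAl.
  by rewrite !mxE big_ord1 !mxE; ring.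
(* By [second_form_cylinder] both instances contain the slice form at the pair (0, 0). The case s =
   0 shows that it vanishes, and s = 1 then gives N nu(N) = lambda N^2. *)
have slice0 := slice 0; have slice1 := slice 1%:M.
move: slice0 slice1; rewrite normal_spatial !second_form_cylinder //.
rewrite !mxE eqxx !expr0n !mulr0 subr0 oppr0 => -> /eqP.
rewrite sub0r eqr_opp => /eqP e.
have {}e : N (f q.2) * lambda = vderiv N (nu q.1 q.2).
  apply: (mulfI (lt0r_neq0 N0)); move: e; rewrite mulr1n => e.
  by transitivity (lambda * N (f q.2) ^+ 2 * 1 ^+ 2); [ring|rewrite -e; ring].
by rewrite -e mulrC mulKf // lt0r_neq0.
Qed.

Lemma mean_curvature_cylinder q :
  mean_curvature (static_metric N g) (cylinder f) (eta q)
  = vderiv N (nu q.1 q.2) / N (f q.2) * n%:R.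
Proof.
have [_ tl _ _] := hP.
rewrite (umbilic_mean_curvature (lambda := vderiv N (nu q.1 q.2) / N (f q.2))).
(* The cylinder has dimension 1 + (n - 1), which is n because n > 0. *)
- by rewrite add1n prednK.
- exact: unitmx_timelike.
- by move=> v w; exact: photon_sphere_umbilic.
Qed.

(** On vectors without time component the umbilicity of the cylinder restricts to that of the slice,
    with the same factor; the slice has dimension n - 1. *)
Lemma mean_curvature_slice t x :
  mean_curvature g f (nu t x) = vderiv N (nu t x) / N (f x) * n.-1%:R.
Proof.
have [_ [_ _ pg] _ _] := hL; have [[_ [_ inj _ _]] _ _ _] := hP.
rewrite (umbilic_mean_curvature (lambda := vderiv N (nu t x) / N (f x))) //.
  by apply: unitmx_immersion; [exact: pg | exact: inj].
move=> v w.
have := @photon_sphere_umbilic (t, x) (row_mx 0 v : 'rV_(1 + n.-1))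
  (row_mx 0 w : 'rV_(1 + n.-1)).
rewrite normal_spatial second_form_cylinder // mxE mulr0 subr0 => ->.
congr (_ * _); rewrite !inner_induced !mdiff_cylinder //.
by rewrite /inner block_diag_form !mul0mx add0r.
Qed.

End PhotonSphere.

Theorem corollary5p6 (R : realType) (n : nat) (hn : (3 <= n)%N)
    (M : charted R n) (N : M -> R) (g : tensor02 M)
    (Sigma : charted R n.-1) (f : Sigma -> M)
    (eta : forall q : time_product Sigma, tangent (cylinder f q))
    (hL : static_spacetime N g)
    (hP : photon_sphere N g f)
    (hnd : non_degenerate N f)
    (heta : unit_normal (static_metric N g) eta) :
  let nu := slice_normal eta in
  let H (t : R) (x : Sigma) := mean_curvature g f (nu t x) in
  let nuN (t : R) (x : Sigma) := vderiv N (nu t x) in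
  let HH (q : time_product Sigma) :=
    mean_curvature (static_metric N g) (cylinder f) (eta q) in
  let etaN (q : time_product Sigma) := vderiv (static_fun N) (eta q) in
  [/\ forall t x, N (f x) * H t x = (n.-1)%:R * nuN t x,
      (forall t x, 0 < nuN t x * H t x) /\ (forall q, 0 < etaN q * HH q),
      [<-> exists t, exists a, forall x, H t x = a;
           forall t, exists a, forall x, H t x = a;
           exists t, exists a, forall x, nuN t x = a;
           forall t, exists a, forall x, nuN t x = a]
    & (exists a, forall q, HH q = a) <-> (exists a, forall q, etaN q = a)].
Proof.
move=> nu H nuN HH etaN.
have n0 : (0 < n)%N by exact: leq_trans hn.
(* A nonzero factor n - 1 makes the sign of nu(N) H strict and lets H determine nu(N). *)
have n1 : (0 < n.-1)%N by rewrite -ltnS prednK // (leq_trans _ hn).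
have N0 x : 0 < N (f x) by case: hL.
have nuN0 t x : nuN t x != 0 by exact: (vderiv_normal_neq0 hL hP hnd heta).
have nuNt s t x : nuN s x = nuN t x.
  exact: (vderiv_normal_cst hL hP hnd heta).
have HE t x : H t x = nuN t x / N (f x) * n.-1%:R.
  exact: mean_curvature_slice.
have HHE q : HH q = nuN q.1 q.2 / N (f q.2) * n%:R.
  exact: mean_curvature_cylinder.
have etaNE q : etaN q = nuN q.1 q.2.
  by rewrite /etaN vderiv_static_fun (normal_spatial hL hP heta) row_mxKr.
(* Time independence of nu(N) passes to H, so one slice decides for all of them. *)
have Ht s t x : H s x = H t x by rewrite !HE (nuNt s t).
have [a Na] : exists a, forall x, N (f x) = a.
  by case: hP => _ _ _ [a Na]; exists a => x; exact: (Na (0, x)).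
(* With N equal to [a] on Sigma, a mean curvature is nu(N) times m / a, where m is n - 1 for [H] and
   n for [HH]; multiplying by a / m recovers nu(N). *)
have cancel t x m : (0 < m)%N -> nuN t x / a * m%:R * a / m%:R = nuN t x.
  move=> m0; rewrite [_ * a]mulrAC divfK -?(Na x) ?lt0r_neq0 // mulfK //.
  by rewrite pnatr_eq0 -lt0n.
(* The product is nu(N)^2 m / N, positive because nu(N) does not vanish. *)
have pos t x m : (0 < m)%N -> 0 < nuN t x * (nuN t x / N (f x) * m%:R).
  move=> m0; rewrite !mulrA -expr2 mulr_gt0 ?ltr0n //.
  by rewrite divr_gt0 // lt_neqAle sqr_ge0 andbT eq_sym sqrf_eq0.
split.
- by move=> t x; rewrite HE mulrCA mulrA mulfVK ?lt0r_neq0 // mulrC.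
- by split=> [t x|q]; rewrite ?HE ?HHE ?etaNE; exact: pos.
- tfae.
  + by move=> [t [b Hb]] s; exists b => x; rewrite (Ht s t).
  (* The witness solves b = nu(N) (n - 1) / a for nu(N); time 0 is an arbitrary choice of slice. *)
  + move=> /(_ 0)[b Hb]; exists 0, (b * a / n.-1%:R) => x.
    by rewrite -(Hb x) HE Na cancel.
  + by move=> [t [b Hb]] s; exists b => x; rewrite (nuNt s t).
  + move=> /(_ 0)[b Hb]; exists 0, (b / a * n.-1%:R) => x.
    by rewrite HE Hb Na.
- split=> -[b Hb].
    by exists (b * a / n%:R) => q; rewrite etaNE -(Hb q) HHE Na cancel.
  by exists (b / a * n%:R) => q; rewrite HHE -etaNE Hb Na.
Qed.
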